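(* Let $n\ge 3$. The polynomial equation $$U_{n-1}(x)+\mathrm{i}U_{n-2}(x)+T_{n-1}(x)-\mathrm{i}T_n(x)=0$$ in the complex unknown $x$ has $n$ distinct roots, and if $x$ is a root, then so is $-\bar{x}$.
   Context: $\mathrm{i}=\sqrt{-1}$ and $\bar{x}$ is the complex conjugate of $x$. $T_k$ and $U_k$ denote the Chebyshev polynomials of the first and second kind, of degree $k$, characterized by $T_k(\cos\theta)=\cos(k\theta)$ and $U_k(\cos\theta)=\sin((k+1)\theta)/\sin\theta$, regarded as polynomials in a complex variable. The integer $n$ is the number of time steps, i.e. the order of an $n\times n$ time discretization matrix whose last row involves three consecutive entries, so $n\ge 3$. *)

(* Defs.v *)
From HB Require Import structures.
From mathcomp Require Import all_boot all_order all_algebra.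
From mathcomp Require Import complex ring.
From mathcomp Require Import reals trigo.
Set Implicit Arguments.
Unset Strict Implicit.
Unset Printing Implicit Defensive.
Import Order.TTheory GRing.Theory Num.Theory.
Local Open Scope ring_scope.

(* The trigonometric characterizations are chebTP and chebUP below, the       *)
(* degrees are size_chebT and size_chebU.                                     *)
Fixpoint chebT (A : nzRingType) (k : nat) : {poly A} :=
  match k with
  | 0 => 1
  | k1.+1 => match k1 with
             | 0 => 'X
             | k2.+1 => 'X * chebT A k1 *+ 2 - chebT A k2
             end
  end.

Fixpoint chebU (A : nzRingType) (k : nat) : {poly A} :=
  match k with
  | 0 => 1
  | k1.+1 => match k1 with
             | 0 => 'X *+ 2
             | k2.+1 => 'X * chebU A k1 *+ 2 - chebU A k2
             end
  end.

Lemma chebTSS (A : nzRingType) (k : nat) :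
  chebT A k.+2 = 'X * chebT A k.+1 *+ 2 - chebT A k.
Proof. by []. Qed.

Lemma chebUSS (A : nzRingType) (k : nat) :
  chebU A k.+2 = 'X * chebU A k.+1 *+ 2 - chebU A k.
Proof. by []. Qed.

Lemma nat_ind2 (P : nat -> Prop) :
  P 0%N -> P 1%N -> (forall k, P k -> P k.+1 -> P k.+2) -> forall k, P k.
Proof.
move=> P0 P1 PS k; suff: P k /\ P k.+1 by case.
by elim: k => [|k [Pk Pk1]]; split=> //; apply: PS.
Qed.

Lemma size_XMn2B (A : numDomainType) (p q : {poly A}) (m : nat) :
  size q = m.+1 -> size p = m.+2 -> size ('X * p *+ 2 - q) = m.+3.
Proof.
move=> sq sp.
have p0 : p != 0 by rewrite -size_poly_eq0 sp.
have s2 : size ('X * p *+ 2) = m.+3.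
  rewrite -scaler_nat size_scale ?pnatr_eq0 //.
  by rewrite mulrC size_mulX // sp.
by rewrite size_polyDl ?s2 // size_polyN sq ltnS leqW.
Qed.

Lemma size_chebT (A : numDomainType) (k : nat) : size (chebT A k) = k.+1.
Proof.
elim/nat_ind2: k => [||k IH1 IH2].
- exact: size_poly1.
- exact: size_polyX.
- by rewrite chebTSS (size_XMn2B IH1 IH2).
Qed.

Lemma size_chebU (A : numDomainType) (k : nat) : size (chebU A k) = k.+1.
Proof.
elim/nat_ind2: k => [||k IH1 IH2].
- exact: size_poly1.
- by rewrite /= -scaler_nat size_scale ?pnatr_eq0 // size_polyX.
- by rewrite chebUSS (size_XMn2B IH1 IH2).
Qed.

Local Open Scope complex_scope.

Lemma chebT_cos (R : realType) (k : nat) (t : R) :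
  (chebT R[i] k).[(cos t)%:C] = (cos (k%:R * t))%:C.
Proof.
elim/nat_ind2: k => [||k IH1 IH2].
- by rewrite mul0r cos0 hornerC.
- by rewrite mul1r hornerX.
- rewrite chebTSS hornerD hornerN hornerMn hornerM hornerX IH1 IH2.
  rewrite -rmorphM -rmorphMn -rmorphB; congr (_%:C).
  have -> : k.+2%:R * t = k.+1%:R * t + t by rewrite -[k.+2]addn1 natrD; ring.
  have -> : k%:R * t = k.+1%:R * t - t by rewrite -[k.+1]addn1 natrD; ring.
  by rewrite cosB cosD; ring.
Qed.

Lemma chebU_sin (R : realType) (k : nat) (t : R) :
  (chebU R[i] k).[(cos t)%:C] * (sin t)%:C = (sin (k.+1%:R * t))%:C.
Proof.
elim/nat_ind2: k => [||k IH1 IH2].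
- by rewrite mul1r hornerC mul1r.
- rewrite hornerMn hornerX -rmorphMn -rmorphM; congr (_%:C).
  have -> : 2%:R * t = t + t by ring.
  by rewrite sinD; ring.
- rewrite chebUSS hornerD hornerN hornerMn hornerM hornerX mulrBl.
  rewrite -mulrnAl -mulrA IH1 IH2.
  rewrite -rmorphMn -rmorphM -rmorphB; congr (_%:C).
  have -> : k.+3%:R * t = k.+2%:R * t + t by rewrite -[k.+3]addn1 natrD; ring.
  have -> : k.+1%:R * t = k.+2%:R * t - t by rewrite -[k.+2]addn1 natrD; ring.
  by rewrite sinB sinD; ring.
Qed.

Lemma poly_cos_inj (R : realType) (p q : {poly R[i]}) :
  (forall t : R, sin t != 0 -> p.[(cos t)%:C] = q.[(cos t)%:C]) -> p = q.
Proof.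
move=> pq; apply/eqP; rewrite -subr_eq0; apply/negP => /negP d0.
pose f (m : nat) : R := m.+2%:R^-1.
have f01 m : 0 < f m < 1.
  by rewrite invr_gt0 ltr0n /= invf_lt1 ?ltr0n // ltr1n.
pose s := [seq (f m)%:C | m <- iota 0 (size (p - q))].
have us : uniq s.
  rewrite map_inj_uniq ?iota_uniq // => a b /complexI /invr_inj /eqP.
  by rewrite eqr_nat => /eqP [].
have rs : all (root (p - q)) s.
  apply/allP => _ /mapP [m _ ->].
  have /andP[f0 f1] := f01 m.
  have fm : -1 < f m by apply: lt_trans f0; rewrite oppr_lt0.
  have cE : cos (acos (f m)) = f m by rewrite acosK // in_itv /= !ltW.
  rewrite rootE hornerD hornerN subr_eq0 -cE; apply/eqP/pq.
  rewrite sin_acos ?ltW // gt_eqF // sqrtr_gt0 subr_gt0.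
  by rewrite expr2 mulr_ilt1 // ltW.
by have := max_poly_roots d0 rs us; rewrite size_map size_iota ltnn.
Qed.

Lemma chebTP (R : realType) (k : nat) (p : {poly R[i]}) :
  p = chebT R[i] k <->
  forall t : R, p.[(cos t)%:C] = (cos (k%:R * t))%:C.
Proof.
split=> [-> t|pE]; first exact: chebT_cos.
by apply: poly_cos_inj => t _; rewrite pE chebT_cos.
Qed.

Lemma chebUP (R : realType) (k : nat) (p : {poly R[i]}) :
  p = chebU R[i] k <->
  forall t : R, sin t != 0 ->
    p.[(cos t)%:C] = (sin (k.+1%:R * t) / sin t)%:C.
Proof.
have UE (t : R) : sin t != 0 ->
    (chebU R[i] k).[(cos t)%:C] = (sin (k.+1%:R * t) / sin t)%:C.
  move=> st; have st' : (sin t)%:C != 0 by rewrite (inj_eq (@complexI R)).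
  by apply: (mulIf st'); rewrite chebU_sin -rmorphM divfK.
split=> [-> //|pE].
by apply: poly_cos_inj => t st; rewrite pE // UE.
Qed.

(* Main.v *)
Require Import Defs.
From mathcomp Require Import all_boot all_order all_algebra.
From mathcomp Require Import separable.
From mathcomp Require Import complex ring zify.
From mathcomp Require Import reals.
Import Order.TTheory GRing.Theory Num.Theory.
Local Open Scope ring_scope.

(** Eliminating [T_n] and [T_(n-1)] in favour of second-kind polynomials, the
    left-hand side of the equation becomes
      [P = (2 - i x) U_(n-1) + i (2 + i x) U_(n-2)],
    a polynomial of degree [n] over an algebraically closed field; it has [n]
    distinct roots as soon as [P] and [P'] have no common zero.

    The derivatives of [a = U_(n-1)] and [b = U_(n-2)], multiplied by
    [x^2 - 1], are combinations of [a] and [b] with coefficients affine in [x]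
    ([chebU_deriv]).  Hence [P(x) = 0] and [(x^2 - 1) P'(x) = 0] form a
    homogeneous linear system in [(a, b)].  Since [a^2 - 2 x a b + b^2 = 1]
    ([chebU_norm]), this vector is nonzero, so the determinant of the system
    vanishes; it factors as [- x^2 ((2 n - 1) i x + 3)] ([multiple_root_loc]).
    A multiple root could thus only be [0] or [i c] with [c = 3 / (2 n - 1)].
    At [0], [P = 2 (a + i b)] cannot vanish because [a^2 + b^2 = 1].  At [i c],
    with [c > 0], [U_k (i c)] is [i^k] times a positive real
    ([chebU_imaginary]), so that [P (i c)] is [i^(n-1)] times
    [(2 + c) s + (2 - c) s'] with [s, s' > 0], which is positive as [c < 2].

    The symmetry follows from the parity of the [U_k] and the reality of their
    coefficients: [P (- conj x) = (-1)^(n-1) conj (P x)]. *)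

(** * Chebyshev polynomials over a commutative ring *)

Section ChebyshevIdentities.

Variable A : comNzRingType.
Implicit Types (x : A) (k : nat).

Lemma horner_chebUSS k x :
  (chebU A k.+2).[x] = 2%:R * x * (chebU A k.+1).[x] - (chebU A k).[x].
Proof. by rewrite chebUSS !hornerE; ring. Qed.

(** These are the addition formulas
    [sin t cos (k + 1) t = sin (k + 2) t - cos t sin (k + 1) t] and
    [sin t cos (k + 2) t = cos t sin (k + 2) t - sin (k + 1) t],
    divided by [sin t]. *)
Lemma chebT_chebU k :
  chebT A k.+1 = chebU A k.+1 - 'X * chebU A k /\
  chebT A k.+2 = 'X * chebU A k.+1 - chebU A k.
Proof.
elim: k => [|k [IH1 IH2]]; first by split; rewrite /=; ring.
split; first by rewrite IH2 chebUSS; ring.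
by rewrite chebTSS IH1 IH2 chebUSS; ring.
Qed.

(** The form [a^2 - 2 x a b + b^2] is invariant under the recurrence step
    [(a, b) |-> (2 x a - b, a)]. *)
Lemma chebU_norm k x :
  (chebU A k.+1).[x] ^+ 2 + (chebU A k).[x] ^+ 2
    = 1 + 2%:R * x * (chebU A k.+1).[x] * (chebU A k).[x].
Proof.
elim: k => [|k IH]; first by rewrite /= !hornerE; ring.
rewrite horner_chebUSS.
set a := (chebU A k.+1).[x] in IH *; set b := (chebU A k).[x] in IH *.
transitivity (a ^+ 2 + b ^+ 2 + 4%:R * x ^+ 2 * a ^+ 2 - 4%:R * x * a * b).
  by ring.
by rewrite IH; ring.
Qed.

(** The span of [U_(k+1)], [U_k] and their multiples by [x] contains the
    images of both under [(x^2 - 1) d/dx]; proving the two equations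
    together makes the induction close up under the recurrence. *)
Lemma chebU_deriv k :
  ('X ^+ 2 - 1) * (chebU A k.+1)^`()
    = k.+1%:R * 'X * chebU A k.+1 - k.+2%:R * chebU A k /\
  ('X ^+ 2 - 1) * (chebU A k)^`()
    = k.+1%:R * chebU A k.+1 - k.+2%:R * 'X * chebU A k.
Proof.
elim: k => [|k [IH1 IH2]].
  by split; rewrite /= ?derivMn ?derivX ?derivC; ring.
have E3 : k.+3%:R = k.+1%:R + 2%:R :> {poly A} by rewrite -[k.+3]addn2 natrD.
have E2 : k.+2%:R = k.+1%:R + 1 :> {poly A} by rewrite -[k.+2]addn1 natrD.
split; last by rewrite IH1 chebUSS E3 E2; ring.
rewrite chebUSS derivB derivMn derivM derivX mul1r E3 E2.
rewrite E2 in IH1 IH2.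
transitivity (('X ^+ 2 - 1) * chebU A k.+1 *+ 2
  + 'X * (('X ^+ 2 - 1) * (chebU A k.+1)^`()) *+ 2
  - ('X ^+ 2 - 1) * (chebU A k)^`()); first by ring.
by rewrite IH1 IH2; ring.
Qed.

Lemma chebU_opp k x : (chebU A k).[- x] = (-1) ^+ k * (chebU A k).[x].
Proof.
elim/nat_ind2: k => [||k IH1 IH2]; try by rewrite /= !hornerE; ring.
by rewrite !horner_chebUSS IH1 IH2 !exprS; ring.
Qed.

End ChebyshevIdentities.

Lemma rmorph_chebU (A B : comNzRingType) (f : {rmorphism A -> B}) k x :
  f (chebU A k).[x] = (chebU B k).[f x].
Proof.
elim/nat_ind2: k => [||k IH1 IH2].
- by rewrite /= !hornerE rmorph1.
- by rewrite /= !hornerMn !hornerX rmorphMn.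
- by rewrite !horner_chebUSS rmorphB !rmorphM rmorph_nat IH1 IH2.
Qed.

(** * Simplicity and symmetry of the roots *)

Section EquationPolynomial.

Variable R : realType.
Local Notation C := (R[i]).
Local Notation i := ('i%C : C).
Local Notation U := (chebU C).
Implicit Types (x : C) (m : nat).

Lemma sqri : i * i = -1.
Proof. by rewrite -expr2 sqr_i. Qed.

(** The left-hand side of the equation for [n = m + 2], written in the pair
    [(U_(n-1), U_(n-2))]; this shift keeps all indices free of subtraction. *)
Definition eqnPoly m : {poly C} :=
  (2%:R - i%:P * 'X) * U m.+1 + (2%:R * i%:P - 'X) * U m.

Lemma horner_eqnPoly m x :
  (eqnPoly m).[x] = (2%:R - i * x) * (U m.+1).[x]
                     + (2%:R * i - x) * (U m).[x].
Proof. by rewrite /eqnPoly -[2%:R]polyC_natr !hornerE. Qed.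

Lemma horner_deriv_eqnPoly m x :
  (eqnPoly m)^`().[x] =
    (2%:R - i * x) * (U m.+1)^`().[x] - i * (U m.+1).[x]
    + ((2%:R * i - x) * (U m)^`().[x] - (U m).[x]).
Proof.
rewrite /eqnPoly -[2%:R]polyC_natr -polyCM.
rewrite derivD !derivM !derivB !derivC derivM derivC derivX.
rewrite -?polyC1 !(hornerD, hornerN, hornerM, hornerX, hornerC, horner0).
by ring.
Qed.

Lemma eqnPoly_cheb m x :
  (U m.+1).[x] + i * (U m).[x] + (chebT C m.+1).[x] - i * (chebT C m.+2).[x]
    = (eqnPoly m).[x].
Proof.
have [-> ->] := chebT_chebU C m.
rewrite horner_eqnPoly !(hornerD, hornerN, hornerM, hornerX).
by ring.
Qed.

Lemma size_eqnPoly m : size (eqnPoly m) = m.+3.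
Proof.
have i0 : - i != 0 by rewrite oppr_eq0 -sqrf_eq0 sqr_i oppr_eq0 oner_neq0.
have sA : size (2%:R - i%:P * 'X : {poly C}) = 2.
  have -> : 2%:R - i%:P * 'X = (- i)%:P * 'X + 2%:R%:P :> {poly C}.
    by rewrite polyCN polyC_natr; ring.
  by rewrite size_MXaddC polyC_eq0 (negPf i0) size_polyC i0.
have sB : size (2%:R * i%:P - 'X : {poly C}) = 2.
  rewrite -[2%:R]polyC_natr -polyCM -size_polyN opprB; exact: size_XsubC.
have mulU (p : {poly C}) k : size p = 2 -> size (p * U k) = k.+2.
  move=> sp; have p0 : p != 0 by rewrite -size_poly_eq0 sp.
  have U0 : U k != 0 by rewrite -size_poly_eq0 size_chebU.
  by rewrite size_mul // sp size_chebU.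
by rewrite /eqnPoly size_polyDl !mulU.
Qed.

(** At a multiple root the nonzero vector [(U_(m+1) x, U_m x)] lies in the
    kernel of a 2 x 2 matrix; the conclusion is the vanishing of its
    determinant, up to sign. *)
Lemma multiple_root_loc m x :
  root (eqnPoly m) x -> root (eqnPoly m)^`() x ->
  x ^+ 2 * ((2 * m + 3)%:R * i * x + 3%:R) = 0.
Proof.
move=> /rootP; rewrite horner_eqnPoly => E1.
move=> /rootP; rewrite horner_deriv_eqnPoly => E2.
have [/(congr1 (horner^~ x)) Da /(congr1 (horner^~ x)) Db] := chebU_deriv C m.
have N := chebU_norm C m x.
rewrite natrD natrM.
move: Da Db; rewrite -![m.+2%:R]natr1 -![m.+1%:R]natr1.
rewrite -![m%:R]polyC_natr !(hornerD, hornerN, hornerM, hornerXn, hornerX, hornerC).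
move: E1 E2 N; move: (U m.+1).[x] (U m).[x] (U m.+1)^`().[x] (U m)^`().[x].
move=> a b a' b'; move: (m%:R : C) => k E1 E2 N Da Db.
set D := LHS.
(* The second row of the linear system, (x^2 - 1) P'(x) = 0. *)
pose g := - i * (x * x - 1) + (2%:R - i * x) * (k + 1) * x
          + (2%:R * i - x) * (k + 1).
pose h := - (x * x - 1) - (2%:R - i * x) * (k + 1 + 1)
          - (2%:R * i - x) * (k + 1 + 1) * x.
have F2 : g * a + h * b = 0.
  rewrite -(mulr0 (x * x - 1)) -E2.
  transitivity ((2%:R - i * x) * ((x * x - 1) * a')
    + (2%:R * i - x) * ((x * x - 1) * b') - (x * x - 1) * (i * a + b));
    last by ring.
  by rewrite Da Db /g /h; ring.
(* Cramer's rule: D is the opposite of the determinant, so it kills a and b. *)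
have DE : D = (2%:R * i - x) * g - (2%:R - i * x) * h.
  by rewrite /D /g /h; ring: sqri.
have Da0 : D * a = 0.
  transitivity ((2%:R * i - x) * (g * a + h * b)
    - h * ((2%:R - i * x) * a + (2%:R * i - x) * b)); first by rewrite DE; ring.
  by rewrite E1 F2 !mulr0 subr0.
have Db0 : D * b = 0.
  transitivity (g * ((2%:R - i * x) * a + (2%:R * i - x) * b)
    - (2%:R - i * x) * (g * a + h * b)); first by rewrite DE; ring.
  by rewrite E1 F2 !mulr0 subr0.
have -> : D = D * a * a + D * b * b - 2%:R * x * (D * a) * b.
  transitivity (D * (a ^+ 2 + b ^+ 2) - 2%:R * x * (D * a) * b); last by ring.
  by rewrite N; ring.
by rewrite Da0 Db0; ring.
Qed.

(** Substituting [x = i c] turns the recurrence into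
    [s_(k+2) = 2 c s_(k+1) + s_k], which preserves positivity. *)
Lemma chebU_imaginary (c : R) k : 0 < c ->
  exists2 s : R, 0 < s & (U k).[i * (c%:C)%C] = i ^+ k * (s%:C)%C.
Proof.
move=> c0; elim/nat_ind2: k => [||k [s s0 E1] [t t0 E2]].
- by exists 1; rewrite //= !hornerE; ring.
- exists (2%:R * c); first by rewrite mulr_gt0.
  by rewrite /= !hornerE rmorphM rmorph_nat; ring.
exists (2%:R * c * t + s); first by rewrite addr_gt0 // !mulr_gt0.
rewrite horner_chebUSS E1 E2 rmorphD !rmorphM rmorph_nat !exprS.
by ring: sqri.
Qed.

(** Of the two candidates for a multiple root, [0] is excluded by
    [chebU_norm] and [3 i / (2 m + 3)] by a sign argument on the positive
    imaginary axis. *)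
Lemma eqnPoly_simple m x :
  root (eqnPoly m) x -> ~~ root (eqnPoly m)^`() x.
Proof.
move=> rx; apply/negP => /(multiple_root_loc _ _ rx) /eqP.
move/rootP: rx; rewrite horner_eqnPoly => E1.
rewrite mulf_eq0 expf_eq0 /= => /orP[/eqP x0|/eqP x1].
  have := chebU_norm C m x.
  rewrite {}x0 in E1 *.
  have : 2%:R * ((U m.+1).[0] + i * (U m).[0]) = 0 by rewrite -[RHS]E1; ring.
  move/eqP; rewrite mulf_eq0 pnatr_eq0 /= addr_eq0 => /eqP ->.
  move=> /eqP; rewrite -subr_eq0 => /eqP N.
  have /eqP := oner_neq0 C; apply.
  by rewrite -[RHS]oppr0 -N; ring: sqri.
(* At i c with 0 < c < 2, both terms of P have the same complex argument. *)
pose c : R := 3%:R / (2 * m + 3)%:R.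
have d0 : 0 < (2 * m + 3)%:R :> R by rewrite ltr0n addn3.
have c0 : 0 < c by rewrite divr_gt0.
have c2 : c < 2%:R.
  by rewrite ltr_pdivrMr // -natrM ltr_nat mulnDr; lia.
have xE : x = i * (c%:C)%C.
  have dC : (2 * m + 3)%:R != 0 :> C by rewrite pnatr_eq0 addn3.
  apply: (mulfI dC).
  have -> : (2 * m + 3)%:R * (i * (c%:C)%C) = i * 3%:R.
    by rewrite /c fmorph_div !rmorph_nat mulrC -mulrA divfK.
  apply/eqP; rewrite -subr_eq0.
  have -> : (2 * m + 3)%:R * x - i * 3%:R
      = - i * ((2 * m + 3)%:R * i * x + 3%:R) by ring: sqri.
  by rewrite x1 mulr0.
clearbody c.
have [s s0 sE] := chebU_imaginary c m.+1 c0.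
have [t t0 tE] := chebU_imaginary c m c0.
have pos : 0 < (2%:R + c) * s + (2%:R - c) * t.
  apply: addr_gt0; apply: mulr_gt0 => //; first exact: addr_gt0.
  by rewrite subr_gt0.
move: E1; rewrite xE sE tE exprS => /eqP.
have -> : (2%:R - i * (i * (c%:C)%C)) * (i * i ^+ m * (s%:C)%C) +
    (2%:R * i - i * (c%:C)%C) * (i ^+ m * (t%:C)%C)
  = i ^+ m.+1 * (((2%:R + c) * s + (2%:R - c) * t)%:C)%C.
  rewrite !(rmorphD, rmorphM, rmorphN, rmorph_nat) exprS.
  by ring: sqri.
rewrite mulf_eq0 expf_eq0 /= -sqrf_eq0 sqr_i oppr_eq0 oner_eq0 /=.
by rewrite (inj_eq (@complexI R)) gt_eqF.
Qed.

(** The [U_k] have integer coefficients, hence commute with conjugation, and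
    alternate in parity; the relation [conj i = - i] compensates this
    alternation between the two terms. *)
Lemma eqnPoly_sym m x :
  (eqnPoly m).[- x^*%C] = (-1) ^+ m.+1 * ((eqnPoly m).[x])^*%C.
Proof.
suff sym (f : {rmorphism C -> C}) : f i = - i ->
    (eqnPoly m).[- f x] = (-1) ^+ m.+1 * f (eqnPoly m).[x].
  by apply: (sym conjc); apply/eqP; rewrite eq_complex /= oppr0 !eqxx.
move=> fi; rewrite !horner_eqnPoly !chebU_opp -!rmorph_chebU.
rewrite rmorphD !rmorphM !rmorphB !rmorphM rmorph_nat fi exprS.
by ring.
Qed.

Lemma eqnPoly_roots m :
  exists s : seq C,
    [/\ size s = m.+2, uniq s & forall x, (x \in s) = root (eqnPoly m) x].
Proof.
have [s sE] := closed_field_poly_normal (eqnPoly m).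
have P0 : eqnPoly m != 0 by rewrite -size_poly_eq0 size_eqnPoly.
have l0 : lead_coef (eqnPoly m) != 0 by rewrite lead_coef_eq0.
exists s; split.
- apply: succn_inj.
  by rewrite -size_eqnPoly sE size_scale // size_prod_XsubC.
- rewrite -separable_prod_XsubC.
  rewrite -(eqp_separable (eqp_scale _ l0)) -sE.
  rewrite unlock; apply/Pdiv.ClosedField.coprimepP; exact: eqnPoly_simple.
- by move=> x; rewrite sE rootZ // root_prod_XsubC.
Qed.

End EquationPolynomial.

Theorem theorem3p2 (R : realType) (n : nat) (hn : (3 <= n)%N) :
  let eqn (x : R[i]) : Prop :=
    (chebU R[i] (n - 1)).[x] + 'i%C * (chebU R[i] (n - 2)).[x]
      + (chebT R[i] (n - 1)).[x] - 'i%C * (chebT R[i] n).[x] = 0 in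
  (exists s : seq R[i],
      [/\ size s = n, uniq s & forall x : R[i], x \in s <-> eqn x])
  /\ (forall x : R[i], eqn x -> eqn (- x^*%C)).
Proof.
case: n hn => [|[|m]] // _ eqn.
have eqnE x : eqn x <-> root (eqnPoly R m) x.
  rewrite /eqn subn1 subn2.
  rewrite eqnPoly_cheb rootE; split=> [->|/eqP] //; exact: eqxx.
split.
  have [s [szs us sP]] := eqnPoly_roots R m.
  by exists s; split=> // x; rewrite sP; split=> /eqnE.
move=> x /eqnE /rootP x0; apply/eqnE/rootP.
by rewrite eqnPoly_sym x0 conjc0 mulr0.
Qed.
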